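(* Let $\mathscr{I}$ be a non-empty set. For each $i\in\mathscr{I}$ let $\lambda_i$ be a non-zero finite cardinal, let $S_i$ be a Hausdorff pseudocompact (resp., countably pracompact) semitopological monoid with zero, and let $B^0_{\lambda_i}(S_i)$ be a Hausdorff pseudocompact (resp., countably pracompact) topological Brandt $\lambda_i^0$-extension of $S_i$. Suppose that the Tychonoff product $\prod\{S_i\colon i\in\mathscr{I}\}$ is a Hausdorff pseudocompact (resp., countably pracompact) space. Then the direct product $\prod\{B^0_{\lambda_i}(S_i)\colon i\in\mathscr{I}\}$ with the Tychonoff topology is a Hausdorff pseudocompact (resp., countably pracompact) semitopological semigroup.
   Context: The statement comprises two assertions: one with ''pseudocompact'' throughout and one with ''countably pracompact'' throughout. All topological spaces are Hausdorff. A semitopological semigroup is a Hausdorff topological space with a separately continuous associative operation; a semitopological monoid is a semitopological semigroup with identity. Direct products of semigroups carry the coordinatewise operation. Brandt $\lambda^0$-extension: for a monoid $S$ with zero $0_S$ and a cardinal $\lambda\geqslant 1$, $B^0_\lambda(S)$ is the set $\{(\alpha,s,\beta)\colon \alpha,\beta\in\lambda,\ s\in S\setminus\{0_S\}\}\sqcup\{0\}$ with the operation in which $0$ is the zero and $(\alpha,a,\beta)\cdot(\gamma,b,\delta)$ equals $(\alpha,ab,\delta)$ if $\beta=\gamma$ and $ab\neq 0_S$, and equals $0$ otherwise. For $\alpha,\beta\in\lambda$ put $S_{\alpha,\beta}=\{(\alpha,s,\beta)\colon s\in S\setminus\{0_S\}\}\cup\{0\}$. Topological Brandt $\lambda^0$-extension: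 for a semitopological monoid $(S,\tau)$ with zero, it is $B^0_\lambda(S)$ with a Hausdorff topology $\tau_B$ such that $(B^0_\lambda(S),\tau_B)$ is a semitopological semigroup and, for some $\alpha\in\lambda$, the map $0_S\mapsto 0$, $s\mapsto(\alpha,s,\alpha)$ ($s\neq 0_S$) is a homeomorphism of $(S,\tau)$ onto the subspace $S_{\alpha,\alpha}$. A Hausdorff space is pseudocompact if every locally finite family of non-empty open subsets of it is finite (equivalently, each locally finite open cover is finite); no Tychonoff separation is assumed. A space $X$ is countably compact at a subset $A\subseteq X$ if every infinite subset $B\subseteq A$ has an accumulation point in $X$; $X$ is countably pracompact if it is countably compact at some dense subset $A$ of $X$. *)

(* Defs.v *)
From HB Require Import structures.
From mathcomp Require Import all_boot.
From mathcomp Require Import all_classical all_analysis.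

Set Implicit Arguments.
Unset Strict Implicit.
Unset Printing Implicit Defensive.

Local Open Scope classical_set_scope.

(* Hausdorffness is not part of [pseudocompact] and [countably_pracompact]: it
   is stated separately wherever these notions are used. *)

Definition locally_finite (X : topologicalType) (F : set (set X)) : Prop :=
  forall x : X, exists2 V : set X, nbhs x V &
    finite_set [set U | F U /\ U `&` V !=set0].

(* Families are sets of subsets: in an indexed locally finite family of
   non-empty sets each member is repeated only finitely often, so allowing
   repetitions would give the same notion. *)
Definition pseudocompact (X : topologicalType) : Prop :=
  forall F : set (set X),
    (forall U, F U -> open U /\ U !=set0) -> locally_finite F -> finite_set F.

Definition countably_compact_at (X : topologicalType) (A : set X) : Prop :=
  forall B : set X, B `<=` A -> infinite_set B -> limit_point B !=set0.

Definition countably_pracompact (X : topologicalType) : Prop :=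
  exists2 A : set X, dense A & countably_compact_at A.

Definition separately_continuous (X : topologicalType) (mul : X -> X -> X) :
    Prop :=
  (forall a, continuous (mul a)) /\ (forall a, continuous (mul^~ a)).

Definition semitopological_semigroup (X : topologicalType)
    (mul : X -> X -> X) : Prop :=
  [/\ hausdorff_space X, associative mul & separately_continuous mul].

Definition semitopological_monoid_with_zero (X : topologicalType)
    (mul : X -> X -> X) (one zero : X) : Prop :=
  [/\ semitopological_semigroup mul,
      left_id one mul, right_id one mul,
      left_zero zero mul & right_zero zero mul].

Section Brandt.
Context (L : eqType) (S : eqType) (zero : S).

(* [None] is the zero of the extension. *)
Definition brandt : Type := option (L * {s : S | s != zero} * L).

(* (a, s, b) if s != zero, and the zero of the extension otherwise *)
Definition brandt_elt (a : L) (s : S) (b : L) : brandt :=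
  omap (fun u => (a, u, b)) (insub s).

Definition brandt_mul (mul : S -> S -> S) (x y : brandt) : brandt :=
  match x, y with
  | Some (a, s, b), Some (c, t, d) =>
      if b == c then brandt_elt a (mul (val s) (val t)) d else None
  | _, _ => None
  end.

Definition brandt_block (a b : L) : set brandt :=
  [set None] `|` range (fun u : {s : S | s != zero} => Some (a, u, b)).

End Brandt.

Arguments brandt_elt {L S} zero a s b.
Arguments brandt_block {L S} zero a b.

(* [{within A, continuous g}] is continuity of the restriction of g to the
   subspace A. *)
Definition homeomorphism_onto (X Y : topologicalType) (f : X -> Y)
    (A : set Y) : Prop :=
  exists g : Y -> X,
    [/\ range f = A, cancel f g, continuous f & {within A, continuous g}].

(* [Topological T] is the type of topologies on the carrier T, packed with a
   choice structure on T that plays no role here. *)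
Definition brandt_space (L : eqType) (S : eqType) (zero : S)
    (tau : Topological (brandt L zero)) : topologicalType :=
  Topological.Pack tau.

Definition topological_brandt_extension (L : eqType) (S : topologicalType)
    (mul : S -> S -> S) (zero : S) (tau : Topological (brandt L zero)) : Prop :=
  @semitopological_semigroup (brandt_space tau) (brandt_mul mul) /\
  exists a : L,
    @homeomorphism_onto S (brandt_space tau)
      (fun s => brandt_elt zero a s a) (brandt_block zero a a).

Definition prod_mul (I : Type) (X : I -> Type) (mul : forall i, X i -> X i -> X i)
    (x y : prod_topology X) : prod_topology X :=
  fun i => mul i (x i) (y i).

(* Main.v *)
Require Import Defs.
From HB Require Import structures.
From mathcomp Require Import all_boot.
From mathcomp Require Import all_classical all_analysis.

Set Implicit Arguments.
Unset Strict Implicit.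
Unset Printing Implicit Defensive.

Local Open Scope classical_set_scope.

(** The finite Brandt extension B_i is a union of finitely many blocks, and each
    block is a continuous image of S_i: since
    (b, 1, a) (a, s, a) (a, 1, c) = (b, s, c), translations of B_i carry the block
    (a, a), which is homeomorphic to S_i by assumption, onto the block (b, c)
    ([brandt_elt_continuous]).  Hence (b, c, s) |-> (b, s, c) is a continuous
    surjection from (L_i x L_i) x S_i onto B_i, where the finite set L_i x L_i of
    labels is discrete.  Taking the product over i gives a continuous surjection
    [brandt_glue] from K x prod S_i onto prod B_i, where K, the product of the
    finite discrete sets of labels, is compact by Tychonoff's theorem.

    It remains to see that pseudocompactness and countable pracompactness pass
    from a Hausdorff space X to any continuous image Y of K x X with K compact.
    Both say that every locally finite family of sets of a certain kind is finite:
    non-empty open sets in the first case, singletons of points of a dense set in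
    the second.  Given a locally finite family in Y, replace each member V by a
    set of the right kind inside the shadow of V in X, i.e. the projection to X
    of its preimage in K x X.  A tube argument, which is where compactness of K
    enters, shows that the replacements are locally finite; so there are finitely
    many of them, and each comes from finitely many V
    ([feebly_compact_on_transfer]).

    That prod B_i is a Hausdorff semitopological semigroup is checked coordinate
    by coordinate. *)

(** * Locally finite families of sets of a given kind *)

(** Common form of pseudocompactness and countable compactness at a subset. *)
Definition feebly_compact_on (X : topologicalType) (C : set (set X)) : Prop :=
  forall F : set (set X), F `<=` C -> locally_finite F -> finite_set F.

Lemma pseudocompactE (X : topologicalType) :
  pseudocompact X = feebly_compact_on [set U : set X | open U /\ U !=set0].
Proof. by []. Qed.

Definition singletons (X : Type) (A : set X) : set (set X) :=
  [set [set a] | a in A].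

Lemma finite_singletons (X : Type) (A : set X) :
  finite_set (singletons A) -> finite_set A.
Proof.
move=> finP; apply: (@sub_finite_set _ _ (\bigcup_(U in singletons A) U)).
  by move=> a Aa; exists [set a] => //; exists a.
by apply: bigcup_finite => // _ [a _ <-]; exact: finite_set1.
Qed.

(** Without a limit point in X, the singletons of an infinite subset of A
    would form an infinite locally finite family. *)
Lemma feebly_compact_on_points (X : topologicalType) (A : set X) :
  feebly_compact_on (singletons A) -> countably_compact_at A.
Proof.
move=> finA B BA infB; apply: contrapT => nolim; apply: infB.
apply: finite_singletons; apply: finA.
  by move=> _ [b Bb <-]; exists b => //; exact: BA.
move=> x; have : ~ limit_point B x by move=> Bx; apply: nolim; exists x.
rewrite not_limit_pointE => -[V Vx BV]; exists V => //.
apply: (@sub_finite_set _ _ [set [set x]]); last exact: finite_set1.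
move=> _ [[b Bb <-] [_ [-> Vb]]] /=.
by have -> : b = x by apply: BV.
Qed.

(** A limit point x of the union of a locally finite family of singletons is
    impossible: some neighbourhood of x contains only finitely many of these
    points, and, points being closed, those other than x can be removed from
    it. *)
Lemma countably_compact_at_feebly_compact_on (X : topologicalType) (A : set X) :
  hausdorff_space X -> countably_compact_at A -> feebly_compact_on (singletons A).
Proof.
move=> hX cA F FA lfF; apply: contrapT => infF.
pose B := [set a | F [set a]].
have FE : F `<=` singletons B.
  by move=> U FU; have [a _ aU] := FA _ FU; exists a => //; rewrite /B/= aU.
have [x Bx] : limit_point B !=set0.
  apply: cA => [a /FA[b Ab /seteqP[ba _]]|finB].
    by have <- : b = a by apply: ba.
  by apply: infF; apply: sub_finite_set FE _; exact: finite_image.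
have [V Vx finV] := lfF x.
pose D := [set a | B a /\ V a /\ a <> x].
have finD : finite_set D.
  apply: finite_singletons; apply: sub_finite_set finV.
  by move=> _ [a [Ba [Va _]] <-]; split => //; exists a.
have : nbhs x (V `&` ~` D).
  apply: filterI => //; apply: open_nbhs_nbhs; split; last by move=> [_ []].
  apply: closed_openC; apply: (accessible_finite_set_closed.1 _) => //.
  exact: hausdorff_accessible.
by move=> /Bx[y [/eqP yx By [Vy]]]; apply.
Qed.

(** * Continuous images of a compact space times X *)

(** Near a given x, only finitely many members of F meet the image of the whole
    tube over a small neighbourhood of x: every (k, x) has such a box, and
    finitely many boxes cover the fibre over x. *)
Lemma tube_locally_finite (K X Y : topologicalType) (phi : K * X -> Y)
    (F : set (set Y)) :
  compact [set: K] -> continuous phi -> locally_finite F ->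
  forall x : X, exists (N : set X) (E : set (set Y)), [/\ nbhs x N, finite_set E &
    forall x' k D, N x' -> F D -> D (phi (k, x')) -> E D].
Proof.
move=> /compact_near_coveringP cK cphi lfF x.
(* Instead of extracting a finite subcover, the near-covering form of
   compactness is used along the filter of all E containing a large enough
   finite set; its generators supply the finite exceptional set E0. *)
pose G := filter_from (@finite_set (set Y)) (fun E0 => [set E | E0 `<=` E]).
have FG : Filter G.
  apply: filter_from_filter; first by exists set0; exact: finite_set0.
  move=> E1 E2 f1 f2; exists (E1 `|` E2); first by rewrite finite_setU.
  by move=> E /=; rewrite subUset.
pose P (i : X * set (set Y)) k := forall D, F D -> D (phi (k, i.1)) -> i.2 D.
have [|[N H] /= [Nx [E0 finE0 HE0]] NHP] :=
  cK _ (filter_prod (nbhs x) G) P _.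
  move=> k _; have [V Vphi finV] := lfF (phi (k, x)).
  have [[W N] /= [Wk Nx] WN] := cphi (k, x) _ Vphi.
  exists (W, N `*` [set E | [set U | F U /\ U `&` V !=set0] `<=` E]) => /=.
    split => //; exists (N, [set E | [set U | F U /\ U `&` V !=set0] `<=` E]) => //.
    by split => //; exists [set U | F U /\ U `&` V !=set0].
  move=> [k' [x' E]] /= [Wk' [Nx' VE]] D FD Dphi; apply: VE; split => //.
  by exists (phi (k', x')); split => //; exact: (WN (k', x')).
exists N, E0; split => // x' k D Nx' FD Dphi.
by apply: (NHP (x', E0)) Dphi => //; split => //; exact: HE0.
Qed.

(** Tubes are used twice for the choice V |-> c V of a set inside the shadow of
    V: they make the family of all c V locally finite, and a tube around one
    point of a given c V shows that only finitely many members share it. *)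
Lemma feebly_compact_on_transfer (K X Y : topologicalType) (phi : K * X -> Y)
    (C : set (set X)) (D : set (set Y)) :
  compact [set: K] -> continuous phi ->
  (forall V, D V -> exists U,
     [/\ C U, U !=set0 & forall x, U x -> exists k, V (phi (k, x))]) ->
  feebly_compact_on C -> feebly_compact_on D.
Proof.
move=> cK cphi shadow finC F FD lfF.
have tube := tube_locally_finite cK cphi lfF.
have /choice[c cP] V : exists U, F V ->
    [/\ C U, U !=set0 & forall x, U x -> exists k, V (phi (k, x))].
  have [/FD/shadow[U UP]|nFV] := pselect (F V); first by exists U.
  by exists set0.
have finG : finite_set (c @` F).
  apply: finC => [_ [V /cP[CV _ _] <-] //|x].
  have [N [E [Nx finE NE]]] := tube x; exists N => //.
  apply: (@sub_finite_set _ _ (c @` E)); last exact: finite_image.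
  move=> _ [[V FV <-] [x' [cVx' Nx']]]; exists V => //.
  by have [_ _ /(_ _ cVx')[k]] := cP _ FV; exact: NE.
(* F is covered by the fibres of c, of which there are finitely many. *)
have FE : F `<=` \bigcup_(U in c @` F) [set V | F V /\ c V = U].
  by move=> V FV; exists (c V) => //; exists V.
apply: sub_finite_set FE _; apply: bigcup_finite => // _ [V0 FV0 <-].
have [_ [x cx] _] := cP _ FV0; have [N [E [Nx finE NE]]] := tube x.
apply: sub_finite_set finE => V [FV cV]; move: cx; rewrite -cV => cx.
by have [_ _ /(_ _ cx)[k]] := cP _ FV; apply: NE => //; exact: nbhs_singleton.
Qed.

Section compact_times.
Context (K X Y : topologicalType) (phi : K * X -> Y).
Hypotheses (cK : compact [set: K]) (cphi : continuous phi).
Hypothesis surj : forall y, exists p, phi p = y.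

Let open_shadow (V : set Y) : open V -> V !=set0 ->
  open (snd @` (phi @^-1` V)) /\ snd @` (phi @^-1` V) !=set0.
Proof.
move=> oV [y Vy]; split.
  by apply: snd_open; apply: open_comp => // p _; exact: cphi.
by have [p py] := surj y; exists p.2, p => //=; rewrite py.
Qed.

Lemma pseudocompact_transfer : pseudocompact X -> pseudocompact Y.
Proof.
rewrite !pseudocompactE; apply: (feebly_compact_on_transfer cK cphi) => V [oV V0].
have [oU U0] := open_shadow oV V0; exists (snd @` (phi @^-1` V)); split => //.
by move=> _ [[k x] /= Vp <-]; exists k.
Qed.

(** The dense set of Y is the image of K x A, where A is dense in X; the shadow
    of a point phi (k, a) is taken to be a. *)
Lemma countably_pracompact_transfer : hausdorff_space X ->
  countably_pracompact X -> countably_pracompact Y.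
Proof.
move=> hX [A dA cA]; exists (phi @` [set p | A p.2]).
  move=> V V0 oV; have [oU U0] := open_shadow oV V0.
  have [_ [[p Vp <-] Ap]] := dA _ U0 oU.
  by exists (phi p); split => //; exists p.
apply: feebly_compact_on_points.
move: (countably_compact_at_feebly_compact_on hX cA).
apply: (feebly_compact_on_transfer cK cphi) => _ [_ [[k a] /= Aa <-] <-].
exists [set a]; split; [by exists a | by exists a |].
by move=> _ ->; exists k.
Qed.

End compact_times.

(** * Product spaces *)

Lemma prod_continuousP (I : Type) (T : topologicalType)
    (X : I -> topologicalType) (f : T -> prod_topology X) :
  (forall i, continuous (fun t => f t i)) -> continuous f.
Proof.
move=> cf t; apply/cvg_sup => i U [V [[W oW <-] Wfi] WU].
apply: filterS WU _; apply: cf; exact: open_nbhs_nbhs.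
Qed.

Lemma prod_coord_continuous (I : Type) (X : I -> topologicalType) i :
  continuous (fun x : prod_topology X => x i).
Proof. exact: (@proj_continuous {classic I} X i). Qed.

Lemma semitopological_semigroup_prod (I : Type) (X : I -> topologicalType)
    (mul : forall i, X i -> X i -> X i) :
  (forall i, semitopological_semigroup (@mul i)) ->
  semitopological_semigroup (prod_mul mul).
Proof.
move=> X_semi; split.
- by apply: (@hausdorff_product {classic I} X) => i; have [] := X_semi i.
- move=> x y z; apply: functional_extensionality_dep => i.
  by have [_ + _] := X_semi i; apply.
- split=> a; apply: prod_continuousP => i; have [_ _ [cl cr]] := X_semi i.
  + move=> x; apply: continuous_comp; first exact: prod_coord_continuous.
    exact: cl.
  + move=> x; apply: (@continuous_comp (prod_topology X) (X i) (X i) (fun x => x i)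
              (fun u => mul i u (a i))).
      exact: prod_coord_continuous.
    exact: cr.
Qed.

(** * Blocks of a Brandt extension *)

Section brandt.
Context (L : choiceType) (S : topologicalType) (mul : S -> S -> S).
Context (one zero : S).
Hypothesis S_monoid : semitopological_monoid_with_zero mul one zero.

Lemma brandt_elt0 (a b : L) : brandt_elt zero a zero b = None.
Proof. by rewrite /brandt_elt insubF // eqxx. Qed.

Lemma brandt_elt_val (a b : L) (u : {s : S | s != zero}) :
  brandt_elt zero a (val u) b = Some (a, u, b).
Proof. by rewrite /brandt_elt valK. Qed.

(** Because [brandt_elt] sends the zero of S to the zero of the extension, the
    multiplication rule needs no case distinction. *)
Lemma brandt_mul_elt (a b c : L) (s t : S) :
  brandt_mul mul (brandt_elt zero a s b) (brandt_elt zero b t c) =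
  brandt_elt zero a (mul s t) c.
Proof.
have [_ _ _ zl zr] := S_monoid.
have [->|s0] := eqVneq s zero; first by rewrite zl !brandt_elt0.
have [->|t0] := eqVneq t zero.
  by rewrite zr !brandt_elt0 /brandt_mul; case: brandt_elt => [[[]]|].
rewrite -[s]/(val (exist (fun s => s != zero) s s0)).
rewrite -[t]/(val (exist (fun s => s != zero) t t0)).
by rewrite !brandt_elt_val /= eqxx.
Qed.

Lemma brandt_elt_surj (a : L) (x : brandt L zero) :
  exists (p : L * L) (s : S), brandt_elt zero p.1 s p.2 = x.
Proof.
case: x => [[[b u] c]|]; first by exists (b, c), (val u); exact: brandt_elt_val.
by exists (a, a), zero; exact: brandt_elt0.
Qed.

(** Continuity is known for one diagonal block only; two translations transport
    it to all the others. *)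
Lemma brandt_elt_continuous (tau : Topological (brandt L zero)) (b c : L) :
  topological_brandt_extension mul tau ->
  continuous (fun s => brandt_elt zero b s c : brandt_space tau).
Proof.
move=> [[_ _ [cl cr]] [a [_ [_ _ ca _]]]].
have [_ ml mr _ _] := S_monoid.
pose T := brandt_space tau.
pose h : S -> T := fun s => brandt_elt zero a s a.
pose l : T -> T := brandt_mul mul (brandt_elt zero b one a).
pose r : T -> T := (brandt_mul mul)^~ (brandt_elt zero a one c).
have -> : (fun s => brandt_elt zero b s c : T) = l \o (r \o h).
  by apply/funext => s; rewrite /l /r /h /= !brandt_mul_elt mr ml.
move=> s; apply: (@continuous_comp S T T); last exact: cl.
by apply: (@continuous_comp S T T); [exact: ca | exact: cr].
Qed.

End brandt.

(** * The product of Brandt extensions as an image of a compact times a product *)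

Section brandt_product.
Context (I : Type) (L : I -> finType) (S : I -> topologicalType).
Context (mul : forall i, S i -> S i -> S i) (one zero : forall i, S i).
Context (tau : forall i, Topological (brandt (L i) (zero i))).
Hypothesis S_monoid : forall i,
  semitopological_monoid_with_zero (@mul i) (one i) (zero i).
Hypothesis tau_ext : forall i, topological_brandt_extension (@mul i) (tau i).

Let B i : topologicalType := brandt_space (tau i).

(** A point records, for each factor, the block from which a coordinate is
    taken. *)
Definition brandt_labels : topologicalType :=
  prod_topology (fun i => discrete_topology (L i * L i)%type).

Lemma brandt_labels_compact : compact [set: brandt_labels].
Proof.
have := @tychonoff {classic I}
  (fun i => discrete_topology (L i * L i)%type) (fun=> setT).
rewrite (_ : mkset _ = setT); last by apply/seteqP; split.
apply => i; apply: finite_compact; exact: (@finite_finset (L i * L i)%type).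
Qed.

Definition brandt_glue (p : brandt_labels * prod_topology S) :
    prod_topology B :=
  fun i => brandt_elt (zero i) (p.1 i).1 (p.2 i) (p.1 i).2.

(** Labels being discrete in each coordinate, the i-th label is constant on a
    neighbourhood, so only the continuity of a single block map is involved. *)
Lemma brandt_glue_continuous : continuous brandt_glue.
Proof.
apply: prod_continuousP => i [k s] U Ui.
have ck := @brandt_elt_continuous _ _ _ _ _ (S_monoid i) _ (k i).1 (k i).2
  (tau_ext i).
exists ([set k' : brandt_labels | k' i = k i],
        [set s' : prod_topology S |
          U (brandt_elt (zero i) (k i).1 (s' i) (k i).2)]) => /=.
  split.
    apply: (@prod_coord_continuous _
      (fun i => discrete_topology (L i * L i)%type) i k [set k i]).
    exact: discrete_set1.
  exact: prod_coord_continuous (ck (s i) U Ui).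
by move=> [k' s'] /= [ki Us]; rewrite /brandt_glue /= ki.
Qed.

Lemma brandt_glue_surj y : exists p, brandt_glue p = y.
Proof.
have coords i : exists q : (L i * L i) * S i,
    brandt_elt (zero i) q.1.1 q.2 q.1.2 = y i.
  have [_ [a _]] := tau_ext i.
  by have [p [s ps]] := brandt_elt_surj a (y i); exists (p, s).
pose q i := sval (cid (coords i)).
exists (fun i => (q i).1, fun i => (q i).2).
by apply: functional_extensionality_dep => i; exact: svalP (cid (coords i)).
Qed.

End brandt_product.

Theorem theorem2p16 (I : Type) (I_nonempty : inhabited I)
    (lambda : I -> nat) (lambda_gt0 : forall i, 0 < lambda i)
    (S : I -> topologicalType)
    (mul : forall i, S i -> S i -> S i) (one zero : forall i, S i)
    (S_monoid : forall i,
       semitopological_monoid_with_zero (@mul i) (one i) (zero i))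
    (tau : forall i, Topological (brandt 'I_(lambda i) (zero i)))
    (tau_ext : forall i, topological_brandt_extension (@mul i) (tau i)) :
  let B : I -> topologicalType := fun i => brandt_space (tau i) in
  let mulB : forall i, B i -> B i -> B i := fun i => brandt_mul (@mul i) in
  ((forall i, hausdorff_space (S i) /\ pseudocompact (S i)) ->
   (forall i, hausdorff_space (B i) /\ pseudocompact (B i)) ->
   hausdorff_space (prod_topology S) /\ pseudocompact (prod_topology S) ->
   [/\ hausdorff_space (prod_topology B), pseudocompact (prod_topology B) &
       semitopological_semigroup (@prod_mul I B mulB)])
  /\
  ((forall i, hausdorff_space (S i) /\ countably_pracompact (S i)) ->
   (forall i, hausdorff_space (B i) /\ countably_pracompact (B i)) ->
   hausdorff_space (prod_topology S) /\ countably_pracompact (prod_topology S) ->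
   [/\ hausdorff_space (prod_topology B), countably_pracompact (prod_topology B) &
       semitopological_semigroup (@prod_mul I B mulB)]).
Proof.
move=> B mulB.
have semi : semitopological_semigroup (@prod_mul I B mulB).
  by apply: semitopological_semigroup_prod => i; have [] := tau_ext i.
have hB : hausdorff_space (prod_topology B) by have [] := semi.
have cK := @brandt_labels_compact I (fun i => 'I_(lambda i)).
have cglue := brandt_glue_continuous S_monoid tau_ext.
have sglue := brandt_glue_surj tau_ext.
split=> _ _ [hS cS]; split => //.
  exact: (pseudocompact_transfer cK cglue sglue).
exact: (countably_pracompact_transfer cK cglue sglue).
Qed.
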